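(* Let $\epsilon\le 1$. Suppose $\mathcal A$ is an $(\epsilon,\delta)$-differentially private $(\alpha,\beta)$-accurate (agnostic) PAC $k$-learner for a concept class $C$ with sample complexity $n$. Then there is an $(\epsilon,\delta)$-differentially private $(\alpha,\beta)$-accurate (agnostic) empirical $k$-learner $\tilde{\mathcal A}$ for $C$ with sample complexity $m=9n$. Moreover, if $\mathcal A$ is proper, then so is $\tilde{\mathcal A}$.
   Context: Concepts are functions $X\to\{0,1\}$; a $k$-labeled database of size $n$ is an element of $(X\times\{0,1\}^k)^n$. PAC $k$-learner: for every distribution $\mathcal D$ on $X$ and $c_1,\dots,c_k\in C$, given $n$ examples $x_i\sim\mathcal D$ i.i.d. labeled by $(c_1(x_i),\dots,c_k(x_i))$, the output $(h_1,\dots,h_k)$ satisfies $\Pr[\max_j\Pr_{x\sim\mathcal D}[h_j(x)\ne c_j(x)]>\alpha]\le\beta$. Agnostic PAC $k$-learner: for every distribution $\mathcal P$ on $X\times\{0,1\}^k$, given $n$ i.i.d. samples, $\Pr[\max_j(\mathrm{error}_{\mathcal P_j}(h_j)-\min_{c\in C}\mathrm{error}_{\mathcal P_j}(c))>\alpha]\le\beta$, where $\mathcal P_j$ is the marginal on the example and $j$-th label and $\mathrm{error}_{\mathcal P_j}(h)=\Pr_{(x,y)\sim\mathcal P_j}[h(x)\ne y]$. For a labeled sample $S'=((x_i,y_i))_i$, $\mathrm{error}_{S'}(h)$ is the fraction of $i$ with $h(x_i)\neq y_i$. Empirical $k$-learner with sample complexity $m$: for all $c_1,\dots,c_k\in C$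 and every $S=((x_i,c_1(x_i),\dots,c_k(x_i)))_{i=1}^m$, $\Pr[\max_j\mathrm{error}_{S|_j}(h_j)>\alpha]\le\beta$ over the coins, with $S|_j=((x_i,c_j(x_i)))_i$. Agnostic empirical $k$-learner: for every $S\in(X\times\{0,1\}^k)^m$, $\Pr[\max_j(\mathrm{error}_{S|_j}(h_j)-\min_{c\in C}\mathrm{error}_{S|_j}(c))>\alpha]\le\beta$, with $S|_j=((x_i,y_{j,i}))_i$. Proper means hypotheses lie in $C$. Neighboring databases differ in one entry; $(\epsilon,\delta)$-differential privacy means $\Pr[\mathcal A(S)\in T]\le e^\epsilon\Pr[\mathcal A(S')\in T]+\delta$ for all neighbors and output sets $T$. *)

(* Defs.v *)
From HB Require Import structures.
From mathcomp Require Import all_boot all_order all_algebra.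
From mathcomp Require Import all_classical all_reals all_analysis.
From mathcomp Require Import measurable_realfun.

Set Implicit Arguments.
Unset Strict Implicit.
Unset Printing Implicit Defensive.

Import Order.TTheory GRing.Theory Num.Theory.
Import numFieldNormedType.Exports.
Local Open Scope classical_set_scope.
Local Open Scope ring_scope.
Local Open Scope ereal_scope.

Section iid.
Context (d : measure_display) (T : measurableType d) (R : realType).

Definition tuple_cons n (xs : T * n.-tuple T) : n.+1.-tuple T :=
  [tuple of xs.1 :: xs.2].

Lemma measurable_tuple_cons n :
  measurable_fun [set: T * n.-tuple T] (@tuple_cons n).
Proof. exact: (measurable_cons measurable_fst measurable_snd). Qed.

HB.instance Definition _ n :=
  @isMeasurableFun.Build _ _ _ _ (@tuple_cons n) (@measurable_tuple_cons n).

(* The n-fold product measure, i.e. the law of n i.i.d. samples from P. *)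
Fixpoint iid (P : probability T R) n : probability (n.-tuple T) R :=
  if n is n'.+1 then distribution (P \x iid P n') (@tuple_cons n')
  else dirac [tuple].

End iid.

Section privacy.
Context (R : realType) (dZ dY : measure_display).
Context (Z : measurableType dZ) (Y : measurableType dY).

Definition neighbors n (S S' : n.-tuple Z) : Prop :=
  exists i : 'I_n, tnth S i <> tnth S' i /\
    forall i' : 'I_n, i' <> i -> tnth S i' = tnth S' i'.

(* Randomized algorithms on databases of size n are Markov kernels. *)
Definition diff_private n (eps delta : R) (A : R.-pker (n.-tuple Z) ~> Y) :=
  forall S S' : n.-tuple Z, neighbors S S' ->
  forall T : set Y, measurable T ->
    A S T <= (expR eps)%:E * A S' T + delta%:E.

End privacy.

Section errors.
Context (R : realType) (dX : measure_display) (X : measurableType dX).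
Implicit Types (h c : X -> bool) (C : set (X -> bool)).

Definition error (P : set (X * bool) -> \bar R) h : \bar R :=
  P [set z | h z.1 != z.2].

Definition disagreement (D : set X -> \bar R) h c : \bar R :=
  D [set x | h x != c x].

Definition emp_error m (S : m.-tuple (X * bool)) h : \bar R :=
  ((count (fun z => h z.1 != z.2) S)%:R / m%:R)%:E.

Definition label k (c : 'I_k -> X -> bool) (x : X) : X * k.-tuple bool :=
  (x, [tuple c j x | j < k]).

Definition proj_label k (j : 'I_k) (z : X * k.-tuple bool) : X * bool :=
  (z.1, tnth z.2 j).

(* -oo is neutral for the maximum; it is the value of the maximum at k = 0. *)
Definition max_over k (f : 'I_k -> \bar R) : \bar R :=
  \big[maxe/-oo]_(j < k) f j.

End errors.

Section learners.
Context (R : realType) (dX dH : measure_display).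
Context (X : measurableType dX) (H : measurableType dH).

(* Hypotheses are carried by a measurable space H, where ev h : X -> {0,1} is
   the function denoted by h.  The two conditions say that every error
   probability is that of a measurable set, and that it is a measurable
   function of the random hypothesis; they hold trivially when X and H are
   discrete. *)
Definition measurable_hypotheses (ev : H -> X -> bool) : Prop :=
  (forall h, measurable_fun [set: X] (ev h)) /\
  (forall P : probability (X * bool)%type R,
     measurable_fun [set: H] (fun h => error P (ev h))).

Variables (ev : H -> X -> bool) (C : set (X -> bool)) (k : nat).

Notation sample := (X * k.-tuple bool)%type.
Notation output := (k.-tuple H).

Definition proper_learner n (A : R.-pker (n.-tuple sample) ~> output) : Prop :=
  forall S, {ae A S, forall hs : output, forall j, C (ev (tnth hs j))}.

(* In the PAC definitions the integral of A S E over the sample S is the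
   probability of E over both the sample and the coins of A. *)
Definition PAC_learner n (alpha beta : R)
    (A : R.-pker (n.-tuple sample) ~> output) : Prop :=
  forall (D : probability X R) (c : 'I_k -> X -> bool),
    (forall j, C (c j)) ->
    \int[iid D n]_xs
      A [tuple of map (label c) xs]
        [set hs | max_over (fun j => disagreement D (ev (tnth hs j)) (c j))
                  > alpha%:E]
    <= beta%:E.

Definition agnostic_PAC_learner n (alpha beta : R)
    (A : R.-pker (n.-tuple sample) ~> output) : Prop :=
  forall P : probability sample R,
    let err j h := error (pushforward P (proj_label j)) h in
    \int[iid P n]_S
      A S [set hs | max_over (fun j => err j (ev (tnth hs j))
                                       - ereal_inf [set err j c | c in C])
                    > alpha%:E]
    <= beta%:E.

Definition empirical_learner m (alpha beta : R)
    (A : R.-pker (m.-tuple sample) ~> output) : Prop :=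
  forall (c : 'I_k -> X -> bool) (xs : m.-tuple X),
    (forall j, C (c j)) ->
    let S := [tuple of map (label c) xs] in
    let err j h := emp_error R [tuple of map (proj_label j) S] h in
    A S [set hs | max_over (fun j => err j (ev (tnth hs j))) > alpha%:E]
    <= beta%:E.

Definition agnostic_empirical_learner m (alpha beta : R)
    (A : R.-pker (m.-tuple sample) ~> output) : Prop :=
  forall S : m.-tuple sample,
    let err j h := emp_error R [tuple of map (proj_label j) S] h in
    A S [set hs | max_over (fun j => err j (ev (tnth hs j))
                                     - ereal_inf [set err j c | c in C])
                  > alpha%:E]
    <= beta%:E.

End learners.

(* Main.v *)
(* Run [A] on [n] i.i.d. uniform draws from the [m = 9 n] given entries: these
   are i.i.d. samples from the empirical distribution of the database, for which
   population errors are empirical errors, so the accuracy of [A] transfers.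
   For privacy, replace the draws one at a time: a single draw hits the modified
   entry with probability [1/m], so it costs a factor [r = 1 + (e^eps - 1)/m] and
   an additive [delta/m]; after [n] draws the total cost is at most
   [(r^n, n r^n delta / m)], and [r^n <= e^eps], [n r^n / m <= e^eps/9 <= 1].
   The case [n = 0] needs its own argument, since there is no empirical
   distribution; there [A] is compared with its behaviour on a point mass. *)

Require Import Defs.
From HB Require Import structures.
From mathcomp Require Import all_boot all_order all_algebra.
From mathcomp Require Import all_classical all_reals all_analysis.
From mathcomp Require Import measurable_realfun.
From mathcomp Require Import ring lra.

Set Implicit Arguments.
Unset Strict Implicit.
Unset Printing Implicit Defensive.

Import Order.TTheory GRing.Theory Num.Theory.
Import numFieldNormedType.Exports.
Local Open Scope classical_set_scope.
Local Open Scope ring_scope.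

(** Stated for any commutative monoid because it peels off the first draw both in real sums and in
    sums over [\bar R]. *)
Lemma big_tuple_cons (V : Type) (idx : V) (op : Monoid.com_law idx)
    (T : finType) n (F : n.+1.-tuple T -> V) :
  \big[op/idx]_(I : n.+1.-tuple T) F I =
  \big[op/idx]_(t : T) \big[op/idx]_(J : n.-tuple T) F [tuple of t :: J].
Proof.
rewrite pair_big /=
  (reindex (fun p : T * n.-tuple T => [tuple of p.1 :: p.2])) //.
exists (fun I => (thead I, [tuple of behead I])) => [[t J]|I] _ /=.
  by rewrite theadE; congr (_, _); exact: val_inj.
by rewrite [RHS]tuple_eta.
Qed.

(** * Averages over draws with replacement, and their change under one modified entry *)

Section tuple_mean.
Context (R : realFieldType) (T : Type).

Definition draw m n (S : m.-tuple T) (I : n.-tuple 'I_m) : n.-tuple T :=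
  [tuple of map (tnth S) I].

Lemma draw_cons m n (S : m.-tuple T) l (J : n.-tuple 'I_m) :
  draw S [tuple of l :: J] = [tuple of tnth S l :: draw S J].
Proof. exact: val_inj. Qed.

Definition tuple_mean m n (S : m.-tuple T) (f : n.-tuple T -> R) : R :=
  (m ^ n)%:R^-1 * \sum_(I : n.-tuple 'I_m) f (draw S I).

Lemma tuple_mean0 m (S : m.-tuple T) (f : 0.-tuple T -> R) :
  tuple_mean S f = f [tuple].
Proof.
rewrite /tuple_mean expn0 invr1 mul1r (big_pred1 [tuple]).
  by congr f; exact: val_inj.
by move=> I; rewrite [I]tuple0 /= eqxx.
Qed.

Lemma tuple_meanS m n (S : m.-tuple T) (f : n.+1.-tuple T -> R) :
  tuple_mean S f =
  m%:R^-1 * \sum_(l < m)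
    tuple_mean S (fun xs : n.-tuple T => f [tuple of tnth S l :: xs]).
Proof.
rewrite /tuple_mean -mulr_sumr mulrA -invfM -natrM -expnS big_tuple_cons.
by congr (_ * _); under eq_bigr do under eq_bigr do rewrite draw_cons.
Qed.

Lemma ler_tuple_mean m n (S : m.-tuple T) (f g : n.-tuple T -> R) :
  (forall xs, f xs <= g xs) -> tuple_mean S f <= tuple_mean S g.
Proof.
by move=> fg; rewrite /tuple_mean ler_wpM2l ?invr_ge0// ler_sum.
Qed.

Lemma tuple_mean_affine m n (S : m.-tuple T) (f : n.-tuple T -> R) a b :
  (0 < m)%N -> tuple_mean S (fun xs => a * f xs + b) = a * tuple_mean S f + b.
Proof.
move=> m0; rewrite /tuple_mean big_split /= -mulr_sumr sumr_const card_tuple.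
rewrite card_ord mulrDr mulrCA -[b *+ _]mulr_natl mulKf //.
by rewrite pnatr_eq0 -lt0n expn_gt0 m0.
Qed.

Lemma tuple_mean_ge0 m n (S : m.-tuple T) (f : n.-tuple T -> R) :
  (forall xs, 0 <= f xs) -> 0 <= tuple_mean S f.
Proof.
by move=> f0; rewrite /tuple_mean mulr_ge0 ?invr_ge0 ?sumr_ge0.
Qed.

(* Only the entry at which [S] and [S'] differ contributes an error, of weight
   [1/m]; bounding [a (tnth S i)] both by [a (tnth S' i)] and by the mean of [a]
   over [S'] makes the loss factor [1 + (u - 1)/m] instead of [u]. *)
Lemma mean_neighbor m (S S' : m.-tuple T) (i : 'I_m) (a : T -> R) (u del : R) :
  1 <= u ->
  (forall i', i' != i -> tnth S i' = tnth S' i') ->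
  (forall z w, a z <= u * a w + del) ->
  m%:R^-1 * \sum_(l < m) a (tnth S l) <=
  (1 + (u - 1) / m%:R) * (m%:R^-1 * \sum_(l < m) a (tnth S' l)) + del / m%:R.
Proof.
move=> u1 SS' apriv.
have m0 : (0 < m%:R :> R) by rewrite ltr0n (leq_ltn_trans _ (ltn_ord i)).
set z := tnth S i; set av := m%:R^-1 * \sum_(l < m) a (tnth S' l).
have z_av : a z <= u * av + del.
  have : \sum_(l < m) a z <= \sum_(l < m) (u * a (tnth S' l) + del).
    by apply: ler_sum => l _; exact: apriv.
  rewrite big_split /= -mulr_sumr !sumr_const card_ord.
  rewrite -[a z *+ _]mulr_natl -[del *+ _]mulr_natl => h.
  rewrite -(ler_pM2l m0); apply: (le_trans h).
  by rewrite mulrDr mulrCA /av mulVKf ?gt_eqF.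
have sumE : \sum_(l < m) a (tnth S l) = m%:R * av + (a z - a (tnth S' i)).
  rewrite /av mulVKf ?gt_eqF// (bigD1 i) //= [in RHS](bigD1 i) //=.
  rewrite (eq_bigr (fun l => a (tnth S' l))) => [|l /SS' ->//].
  by rewrite -/z; ring.
(* The bound of [a z] by [a (tnth S' i)] plus [u - 1] times [z_av] is exactly [u] times this
   claim. *)
have key : a z - a (tnth S' i) <= (u - 1) * av + del.
  have := apriv z (tnth S' i); rewrite -/z => z_z'.
  have u0 : 0 < u by rewrite (lt_le_trans ltr01).
  have u10 : 0 <= u - 1 by rewrite subr_ge0.
  rewrite -subr_ge0 -(pmulr_rge0 _ u0).
  move: (ler_wpM2l u10 z_av) z_z'.
  rewrite -subr_ge0 => h1; rewrite -subr_ge0 => h2.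
  rewrite [leRHS](_ : _ = (u * a (tnth S' i) + del - a z) +
    ((u - 1) * (u * av + del) - (u - 1) * a z)); last by ring.
  exact: addr_ge0.
rewrite sumE mulrDr mulKf ?gt_eqF// mulrDl mul1r -addrA lerD2l.
rewrite -(ler_pM2l m0) mulVKf ?gt_eqF//; apply: (le_trans key).
by rewrite le_eqVlt; apply/orP; left; apply/eqP; field; rewrite gt_eqF.
Qed.

(** Induction on the draws: [mean_neighbor] moves the first draw from [S] to [S'] while the others
    still come from [S], and the induction hypothesis then moves those. The condition on [f]
    includes [xs = ys], since the entries drawn at position [j] may coincide. *)
Lemma tuple_mean_neighbor m n (S S' : m.-tuple T) (i : 'I_m)
    (f : n.-tuple T -> R) (u del : R) :
  let r := 1 + (u - 1) / m%:R in
  1 <= u -> 0 <= del ->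
  (forall i', i' != i -> tnth S i' = tnth S' i') ->
  (forall xs ys : n.-tuple T, (exists j : 'I_n, forall j', j' != j ->
     tnth xs j' = tnth ys j') -> f xs <= u * f ys + del) ->
  tuple_mean S f <= r ^+ n * tuple_mean S' f + (n%:R * r ^+ n / m%:R) * del.
Proof.
move=> r u1 del0 SS'.
have m0 : (0 < m)%N by rewrite (leq_ltn_trans _ (ltn_ord i)).
have m0R : (0 < m%:R :> R) by rewrite ltr0n.
have r1 : 1 <= r by rewrite lerDl divr_ge0 ?subr_ge0// ltW.
have r0 : 0 <= r by rewrite (le_trans ler01).
elim: n f => [|n IH] f fpriv.
  by rewrite !tuple_mean0 expr0 mul1r !mul0r addr0.
pose g := fun (Q : m.-tuple T) z =>
  tuple_mean Q (fun xs : n.-tuple T => f [tuple of z :: xs]).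
rewrite [tuple_mean S f]tuple_meanS [tuple_mean S' f]tuple_meanS.
rewrite -/(g S) -/(g S').
have gpriv z w : g S z <= u * g S w + del.
  rewrite /g -tuple_mean_affine//; apply: ler_tuple_mean => xs.
  apply: fpriv; exists ord0 => j'.
  by case: (unliftP ord0 j') => [j ->|->]; rewrite ?eqxx// !tnthS.
apply: (le_trans (mean_neighbor u1 SS' gpriv)); rewrite -/r.
have IHz z : g S z <= r ^+ n * g S' z + (n%:R * r ^+ n / m%:R) * del.
  apply: IH => xs ys [j xy]; apply: fpriv; exists (lift ord0 j) => j'.
  case: (unliftP ord0 j') => [k ->|->]; last by [].
  by rewrite !tnthS (inj_eq lift_inj); exact: xy.
have IHmean : m%:R^-1 * \sum_(l < m) g S (tnth S' l) <=
    r ^+ n * (m%:R^-1 * \sum_(l < m) g S' (tnth S' l)) +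
    (n%:R * r ^+ n / m%:R) * del.
  rewrite mulrCA -(ler_pM2l m0R) mulrDr !mulVKf ?gt_eqF//.
  apply: (le_trans (ler_sum _ (fun l _ => IHz (tnth S' l)))).
  rewrite big_split /= -mulr_sumr sumr_const card_ord.
  by rewrite -[_ * del *+ _]mulr_natl !mulrA.
apply: (le_trans (lerD (ler_wpM2l r0 IHmean) (lexx _))).
rewrite mulrDr !mulrA -exprS -addrA lerD2l.
(* The first draw adds [del / m]; as [r ^+ n.+1] is at least 1, this is at most one more copy of
   [r ^+ n.+1 * (del / m)], which turns the factor [n] into [n.+1]. *)
have rn1 : 1 <= r ^+ n.+1 by exact: exprn_ege1.
have dm0 : 0 <= del / m%:R by rewrite divr_ge0// ltW.
rewrite [leLHS](_ : _ =
    n%:R * r ^+ n.+1 * (del / m%:R) + del / m%:R); last first.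
  by rewrite exprS; field; rewrite gt_eqF.
rewrite [leRHS](_ : _ =
    n%:R * r ^+ n.+1 * (del / m%:R) + r ^+ n.+1 * (del / m%:R)).
  by rewrite lerD2l ler_peMl.
by rewrite -natr1; field; rewrite gt_eqF.
Qed.

End tuple_mean.

(** * Numerical bounds behind the factor 9 *)

Section amplification_constants.
Context (R : realType).

(** The inequality [1 + x <= expR x] at [x = - 1/2] gives [expR (1/2) <= 2], which is then
    squared. *)
Lemma expR1_le4 : expR 1 <= 4 :> R.
Proof.
have h : expR (2^-1) <= 2 :> R.
  have := expR_ge1Dx (- 2^-1 : R); rewrite expRN => h.
  have e0 := expR_gt0 (2^-1 : R).
  rewrite -(ler_pM2r (x := 2^-1)) ?invr_gt0//.
  rewrite -(ler_pM2l (x := (expR (2^-1))^-1)) ?invr_gt0//.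
  rewrite mulKf ?gt_eqF// mulfV// mulr1; apply: le_trans h.
  by lra.
rewrite [X in expR X](_ : 1 = 2^-1 + 2^-1); last by lra.
rewrite expRD (le_trans (ler_pM _ _ h h)) ?expR_ge0//; lra.
Qed.

(** Multiplying [1 - eps <= expR (- eps)] by [expR eps] gives [expR eps - 1 <= expR eps * eps], and
    [expR eps <= expR 1 <= 4]. *)
Lemma expR_sub1_le (eps : R) : 0 <= eps <= 1 -> expR eps - 1 <= 4 * eps.
Proof.
move=> /andP[eps0 eps1].
have e0 := expR_gt0 eps.
apply: (@le_trans _ _ (expR eps * eps)).
  have := expR_ge1Dx (- eps); rewrite expRN -(ler_pM2l e0) mulfV ?gt_eqF//.
  by rewrite mulrDr mulr1 mulrN; lra.
by rewrite ler_wpM2r// (le_trans _ expR1_le4)// ler_expR.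
Qed.

(** By [1 + x <= expR x] the power is at most the exponential of [(expR eps - 1) / 9], and this
    exponent is at most [4 * eps / 9]. *)
Lemma subsampling_rate (n : nat) (eps : R) : (0 < n)%N -> 0 <= eps <= 1 ->
  (1 + (expR eps - 1) / (9 * n)%:R) ^+ n <= expR eps.
Proof.
move=> n0 eps01; have /andP[eps0 eps1] := eps01.
have n0R : (0 < n%:R :> R) by rewrite ltr0n.
have e1 : 0 <= expR eps - 1 by rewrite subr_ge0 -expR0 ler_expR.
apply: (@le_trans _ _ (expR ((expR eps - 1) / (9 * n)%:R) ^+ n)).
  by rewrite lerXn2r ?nnegrE ?expR_ge0 ?expR_ge1Dx// addr_ge0// divr_ge0.
rewrite -expRM_natl ler_expR.
rewrite [leLHS](_ : _ = (expR eps - 1) / 9); last first.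
  by rewrite natrM; field; rewrite gt_eqF.
have := expR_sub1_le eps01; lra.
Qed.

End amplification_constants.

(** * Finite averages of measures *)

Section mean_measure.
Local Open Scope ereal_scope.
Context d (T : measurableType d) (R : realType).
Implicit Types s : seq {measure set T -> \bar R}.
Local Notation m0 := (mzero : {measure set T -> \bar R}).

(** Built from [mscale] and [msum] so that the measure structure is inferred; the default [m0] of
    [nth] is never reached. *)
Definition mean_measure s : {measure set T -> \bar R} :=
  mscale (NngNum (divr_ge0 (@ler01 R) (ler0n R (size s))))
    (msum (nth m0 s) (size s)).

Lemma mean_measureE s U :
  mean_measure s U = ((size s)%:R^-1)%:E * \sum_(mu <- s) mu U.
Proof.
rewrite /mean_measure /= /mscale /= div1r /msum; congr (_ * _).
by rewrite (big_nth m0) big_mkord.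
Qed.

Lemma mean_measure_setT s : (0 < size s)%N ->
  (forall i, (i < size s)%N -> nth m0 s i setT = 1) ->
  mean_measure s setT = 1.
Proof.
move=> s0 s1; rewrite mean_measureE (big_nth m0) big_mkord.
rewrite (eq_bigr (fun=> 1)) => [|i _]; last exact: s1.
rewrite sumEFin -EFinM sumr_const card_ord mulVf//.
by rewrite pnatr_eq0 -lt0n.
Qed.

Lemma ge0_integral_mean_measure s (f : T -> \bar R) :
  measurable_fun setT f -> (forall x, 0 <= f x) ->
  \int[mean_measure s]_x f x =
  ((size s)%:R^-1)%:E * \sum_(mu <- s) \int[mu]_x f x.
Proof.
move=> mf f0; rewrite /mean_measure ge0_integral_mscale//= div1r; congr (_ * _).
by rewrite ge0_integral_measure_sum// (big_nth m0) big_mkord.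
Qed.

End mean_measure.

(** * Empirical measures and integration over i.i.d. draws from them *)

Section empirical_measure.
Local Open Scope ereal_scope.
Context d (T : measurableType d) (R : realType).

(** The proof of [0 < m] is part of the term so that the probability instance declared below can be
    inferred from it. *)
Definition emp_measure m (_ : (0 < m)%N) (S : m.-tuple T) : set T -> \bar R :=
  mean_measure [seq \d_x : {measure set T -> \bar R} | x <- S].

Lemma emp_measure_setT m (m_gt0 : (0 < m)%N) (S : m.-tuple T) :
  emp_measure m_gt0 S setT = 1.
Proof.
rewrite /emp_measure mean_measure_setT ?size_map ?size_tuple// => i iS.
by rewrite (nth_map point) ?size_tuple//= diracT.
Qed.

HB.instance Definition _ m (m_gt0 : (0 < m)%N) (S : m.-tuple T) :=
  Measure.on (emp_measure m_gt0 S).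
HB.instance Definition _ m (m_gt0 : (0 < m)%N) (S : m.-tuple T) :=
  Measure_isProbability.Build _ _ _ (emp_measure m_gt0 S)
    (emp_measure_setT m_gt0 S).

Lemma emp_measure_count m (m_gt0 : (0 < m)%N) (S : m.-tuple T) (p : pred T) :
  emp_measure m_gt0 S [set x | p x] = ((count p S)%:R / m%:R)%:E.
Proof.
rewrite /emp_measure mean_measureE size_map size_tuple big_map.
under eq_bigr do rewrite /= diracE mem_setE.
rewrite sumEFin -EFinM mulrC -natr_sum -sum1_count [in RHS]big_mkcond /=.
by congr ((_%:R / _)%:E); apply: eq_bigr => x _; case: (p x).
Qed.

Lemma ge0_integral_emp_measure m (m_gt0 : (0 < m)%N) (S : m.-tuple T)
    (f : T -> \bar R) :
  measurable_fun setT f -> (forall x, 0 <= f x) ->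
  \int[emp_measure m_gt0 S]_x f x = (m%:R^-1)%:E * \sum_(l < m) f (tnth S l).
Proof.
move=> mf f0; rewrite ge0_integral_mean_measure// size_map size_tuple big_map.
rewrite big_tuple; congr (_ * _).
by apply: eq_bigr => l _; rewrite integral_dirac// diracT mul1e.
Qed.

Lemma ge0_integral_iidS (P : probability T R) n (f : n.+1.-tuple T -> \bar R) :
  measurable_fun setT f -> (forall x, 0 <= f x) ->
  \int[iid P n.+1]_x f x =
  \int[P]_z \int[iid P n]_xs f [tuple of z :: xs].
Proof.
move=> mf f0; rewrite /= ge0_integral_distribution//.
rewrite fubini_tonelli1//.
  by apply: measurableT_comp => //; exact: measurable_tuple_cons.
by move=> z; exact: f0.
Qed.

(** Identifies [n] i.i.d. draws from the empirical measure with a uniform choice among the [m ^ n]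
    index tuples, the form in which [subsample] is defined; the induction integrates out the first
    draw. *)
Lemma ge0_integral_iid_emp_measure m (m_gt0 : (0 < m)%N) (S : m.-tuple T) n
    (f : n.-tuple T -> \bar R) :
  measurable_fun setT f -> (forall x, 0 <= f x) ->
  \int[iid (emp_measure m_gt0 S) n]_x f x =
  ((m ^ n)%:R^-1)%:E * \sum_(I : n.-tuple 'I_m) f (draw S I).
Proof.
elim: n f => [|n IH] f mf f0.
  rewrite /= integral_dirac// diracT expn0 invr1.
  rewrite (big_pred1 [tuple]) => [|I]; last by rewrite [I]tuple0 /= eqxx.
  by rewrite !mul1e; congr f; exact: val_inj.
have mcons z : measurable_fun setT (fun xs : n.-tuple T => f [tuple of z :: xs]).
  apply: (measurableT_comp mf); exact: measurable_cons.
rewrite ge0_integral_iidS// ge0_integral_emp_measure//.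
- under eq_bigr do rewrite IH//.
  rewrite -ge0_sume_distrr => [|l _]; last exact: sume_ge0.
  rewrite muleA -EFinM -invfM -natrM -expnS big_tuple_cons; congr (_ * _).
  by under [RHS]eq_bigr do under eq_bigr do rewrite draw_cons.
- apply: (measurable_fun_fubini_tonelli_F
    (fun p => f (tuple_cons p))) => //.
  by apply: measurableT_comp => //; exact: measurable_tuple_cons.
- by move=> z; exact: integral_ge0.
Qed.

End empirical_measure.

(** * The subsampled algorithm as a probability kernel *)

Section subsample.
Local Open Scope ereal_scope.
Context (R : realType) (dZ dY : measure_display).
Context (Z : measurableType dZ) (Y : measurableType dY).
Context (m n : nat) (mn_gt0 : (0 < m ^ n)%N) (A : R.-pker (n.-tuple Z) ~> Y).

Lemma measurable_draw (I : n.-tuple 'I_m) :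
  measurable_fun [set: m.-tuple Z] (fun S => draw S I).
Proof.
apply/measurable_fun_tnthP => i.
rewrite (_ : _ \o _ = fun S : m.-tuple Z => tnth S (tnth I i)).
  exact: measurable_tnth.
by apply/funext => S; rewrite /= tnth_map.
Qed.

(* [mn_gt0] excludes the uniform law on an empty set of index tuples. *)
Definition subsample (_ : (0 < m ^ n)%N) (S : m.-tuple Z) :
    {measure set Y -> \bar R} :=
  mean_measure [seq A (draw S J) : {measure set Y -> \bar R}
               | J <- enum {: n.-tuple 'I_m}].

Lemma size_enum_draw : size (enum {: n.-tuple 'I_m}) = (m ^ n)%N.
Proof. by rewrite -cardE card_tuple card_ord. Qed.

Lemma subsampleE S U : subsample mn_gt0 S U =
  ((m ^ n)%:R^-1)%:E * \sum_(I : n.-tuple 'I_m) A (draw S I) U.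
Proof.
by rewrite /subsample mean_measureE size_map size_enum_draw big_map big_enum.
Qed.

Lemma measurable_subsample U : measurable U ->
  measurable_fun [set: m.-tuple Z] (fun S => subsample mn_gt0 S U).
Proof.
move=> mU; under eq_fun do rewrite subsampleE.
apply: measurable_funeM; apply: emeasurable_sum => I.
apply: (measurableT_comp (measurable_kernel A U mU)); exact: measurable_draw.
Qed.

HB.instance Definition _ :=
  isKernel.Build _ _ _ _ R (subsample mn_gt0) measurable_subsample.

Lemma subsample_setT S : subsample mn_gt0 S setT = 1.
Proof.
rewrite subsampleE; under eq_bigr do rewrite prob_kernel.
rewrite sumEFin -EFinM sumr_const card_tuple card_ord mulVf//.
by rewrite pnatr_eq0 -lt0n.
Qed.

HB.instance Definition _ :=
  Kernel_isProbability.Build _ _ _ _ R (subsample mn_gt0) subsample_setT.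

Lemma pker_fineK S U : measurable U -> (fine (A S U))%:E = A S U.
Proof.
move=> mU; rewrite fineK// ge0_fin_numE//.
by rewrite (@le_lt_trans _ _ 1) ?ltry// -(prob_kernel (s := A) S)
  le_measure ?inE.
Qed.

(** Passes from [\bar R] to the real averages whose privacy loss is bounded by
    [tuple_mean_neighbor]. *)
Lemma subsample_tuple_mean S U : measurable U ->
  subsample mn_gt0 S U = (tuple_mean S (fun xs => fine (A xs U)))%:E.
Proof.
move=> mU; rewrite subsampleE /tuple_mean EFinM -sumEFin; congr (_ * _).
by apply: eq_bigr => I _; rewrite pker_fineK.
Qed.

(** Carries properness over. A point outside [E] lies in every null cover [N (draw S I)], hence in
    their intersection, on which each term of the average vanishes. *)
Lemma subsample_ae (E : set Y) S :
  (forall xs, {ae A xs, forall y, E y}) ->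
  {ae subsample mn_gt0 S, forall y, E y}.
Proof.
move=> AE.
have /choice[N NP] xs : exists N, [/\ measurable N, A xs N = 0 & ~` E `<=` N].
  exact: AE.
exists (\bigcap_(I in [set: n.-tuple 'I_m]) N (draw S I)); split.
- apply: fin_bigcap_measurable => // I _; by case: (NP (draw S I)).
- rewrite subsampleE big1 ?mule0// => I _.
  case: (NP (draw S I)) => mN N0 _; apply/eqP; rewrite eq_le measure_ge0 andbT.
  rewrite -N0 le_measure ?inE//; last exact: bigcap_inf.
  by apply: fin_bigcap_measurable => // J _; case: (NP (draw S J)).
- by move=> y Ey I _; case: (NP (draw S I)) => _ _; exact.
Qed.

End subsample.

(** * Differential privacy under subsampling *)

Lemma diff_private_delta_ge0 (R : realType) (dZ dY : measure_display)
    (Z : measurableType dZ) (Y : measurableType dY) n (eps delta : R)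
    (A : R.-pker (n.-tuple Z) ~> Y) (z z' : Z) :
  (0 < n)%N -> z <> z' -> diff_private eps delta A -> 0 <= delta.
Proof.
case: n A => // n A _ zz' Apriv.
(* The definition of privacy puts no sign on [delta]; on a neighboring pair the empty event forces
   it to be nonnegative. Such a pair takes one position and two distinct points. *)
have nb : neighbors [tuple z | j < n.+1]
    [tuple if j == ord0 then z' else z | j < n.+1].
  exists ord0; rewrite !tnth_mktuple eqxx; split => // j /eqP/negbTE j0.
  by rewrite !tnth_mktuple j0.
have := Apriv _ _ nb _ measurable0.
by rewrite !measure0 mule0 add0e lee_fin.
Qed.

Lemma subsample_diff_private (R : realType) (dZ dY : measure_display)
    (Z : measurableType dZ) (Y : measurableType dY) n (eps delta : R)
    (A : R.-pker (n.-tuple Z) ~> Y) (mn_gt0 : (0 < (9 * n) ^ n)%N) :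
  0 <= eps <= 1 -> diff_private eps delta A ->
  diff_private eps delta (subsample A mn_gt0).
Proof.
move=> eps01 Apriv S S' [i [Si SS']] U mU; have /andP[eps0 eps1] := eps01.
(* The position [i] ranges over [9 * n] indices, so its existence excludes [n = 0]. *)
have n0 : (0 < n)%N by case: (n) i {Si SS' S S' A Apriv mn_gt0} => // -[].
have delta0 : 0 <= delta := diff_private_delta_ge0 n0 Si Apriv.
have u1 : 1 <= expR eps by rewrite -expR0 ler_expR.
rewrite !subsample_tuple_mean// -EFinM -EFinD lee_fin.
have {}SS' i' : i' != i -> tnth S i' = tnth S' i' by move=> /eqP/SS'.
have fpriv (xs ys : n.-tuple Z) :
    (exists j : 'I_n, forall j', j' != j -> tnth xs j' = tnth ys j') ->
    fine (A xs U) <= expR eps * fine (A ys U) + delta.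
  move=> [j xy]; rewrite -lee_fin EFinD EFinM !pker_fineK//.
  (* If the entries at [j] coincide, the tuples are equal rather than neighbors, and the bound
     follows from [1 <= expR eps] and [0 <= delta]. *)
  have [xyj|xyj] := pselect (tnth xs j = tnth ys j); last first.
    by apply: Apriv => //; exists j; split => // j' /eqP/xy.
  have -> : xs = ys.
    by apply: eq_from_tnth => j'; have [->//|/xy] := eqVneq j' j.
  rewrite -(pker_fineK A ys mU) -EFinM -EFinD lee_fin -[leLHS]addr0 lerD//.
  by rewrite ler_peMl// fine_ge0.
apply: (le_trans (tuple_mean_neighbor u1 delta0 SS' fpriv)).
have rle := subsampling_rate n0 eps01.
have mean0 : 0 <= tuple_mean S' (fun xs => fine (A xs U)).
  by apply: tuple_mean_ge0 => xs; rewrite fine_ge0.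
rewrite lerD ?ler_wpM2r// ler_piMl//.
have n0R : (0 < n%:R :> R) by rewrite ltr0n.
rewrite ler_pdivrMr ?ltr0n ?muln_gt0// mul1r [leRHS]natrM mulrC ler_pM2r//.
apply: (le_trans rle); apply: (le_trans _ (_ : 4 <= 9)); last by lra.
by rewrite (le_trans _ (expR1_le4 R))// ler_expR.
Qed.

(** * Subsampling as an expectation over i.i.d. samples *)

Section subsample_integral.
Local Open Scope ereal_scope.
Context d (T : measurableType d) (R : realType).

Lemma integral_iid0 (P : probability T R) (f : 0.-tuple T -> \bar R) :
  \int[iid P 0]_xs f xs = f [tuple].
Proof.
have fE : f = cst (f [tuple]) by apply/funext => xs; rewrite [xs]tuple0.
by rewrite /= integral_dirac ?diracT ?mul1e// fE.
Qed.

Lemma subsample_iid dY (Y : measurableType dY) m n (mn_gt0 : (0 < m ^ n)%N)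
    (m_gt0 : (0 < m)%N) (A : R.-pker (n.-tuple T) ~> Y) S U :
  measurable U ->
  subsample A mn_gt0 S U = \int[iid (emp_measure R m_gt0 S) n]_xs A xs U.
Proof.
move=> mU; rewrite subsampleE ge0_integral_iid_emp_measure//.
exact: measurable_kernel.
Qed.

(** Drawing indices commutes with mapping [g]. This serves the realizable case, where the integral
    runs over unlabeled points and [g] is the labeling. *)
Lemma subsample_map_iid d' (T' : measurableType d') dY (Y : measurableType dY)
    m n (mn_gt0 : (0 < m ^ n)%N) (m_gt0 : (0 < m)%N)
    (A : R.-pker (n.-tuple T') ~> Y) (g : T -> T') (xs : m.-tuple T) U :
  measurable_fun setT g -> measurable U ->
  subsample A mn_gt0 [tuple of map g xs] U =
  \int[iid (emp_measure R m_gt0 xs) n]_ys A [tuple of map g ys] U.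
Proof.
move=> mg mU; rewrite ge0_integral_iid_emp_measure//; last first.
  apply: (measurableT_comp (measurable_kernel A U mU)).
  apply/measurable_fun_tnthP => i.
  rewrite (_ : _ \o _ = g \o (fun ys : n.-tuple T => tnth ys i)).
    by apply: measurableT_comp => //; exact: measurable_tnth.
  by apply/funext => ys; rewrite /= tnth_map.
rewrite subsampleE; congr (_ * _); apply: eq_bigr => I _; congr (A _ U).
by apply: eq_from_tnth => i; rewrite !tnth_map.
Qed.

Lemma subsample_size0 dY (Y : measurableType dY) m (mn_gt0 : (0 < m ^ 0)%N)
    (A : R.-pker (0.-tuple T) ~> Y) S U :
  subsample A mn_gt0 S U = A [tuple] U.
Proof.
rewrite subsampleE expn0 invr1 mul1e (big_pred1 [tuple]).
  by congr (A _ U); exact: val_inj.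
by move=> I; rewrite [I]tuple0 /= eqxx.
Qed.

End subsample_integral.

(** * Transfer of accuracy from population errors to empirical errors *)

Section accuracy.
Local Open Scope ereal_scope.
Context (R : realType) (dX dH : measure_display).
Context (X : measurableType dX) (H : measurableType dH).
Context (ev : H -> X -> bool) (C : set (X -> bool)) (k : nat).
Context (ev_meas : measurable_hypotheses R ev).

(** At [k = 0] both sides fail: the maximum is [-oo], which exceeds no real. *)
Lemma max_over_gtP (f : 'I_k -> \bar R) (a : R) :
  a%:E < max_over f <-> exists j, a%:E < f j.
Proof.
split=> [/bigmax_gtP[//|[j _ aj]]|[j aj]]; first by exists j.
by apply/bigmax_gtP; right; exists j.
Qed.

Lemma measurable_max_over_gt (f : 'I_k -> H -> \bar R) (a : R) :
  (forall j, measurable_fun setT (f j)) ->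
  measurable [set hs : k.-tuple H | a%:E < max_over (fun j => f j (tnth hs j))].
Proof.
move=> mf.
rewrite (_ : [set _ | _] =
    \bigcup_(j in [set: 'I_k]) [set hs : k.-tuple H | a%:E < f j (tnth hs j)]).
  apply: fin_bigcup_measurable => // j _; rewrite -[X in measurable X]setTI.
  apply: emeasurable_fun_o_infty => //.
  by apply: (measurableT_comp (mf j)); exact: measurable_tnth.
apply/seteqP; split => hs /=.
  by move=> /max_over_gtP[j aj]; exists j.
by move=> [j _ aj]; apply/max_over_gtP; exists j.
Qed.

(** The law of [f] under [P] is again a probability on [X * bool], so the second clause of
    [measurable_hypotheses] applies to it. *)
Lemma measurable_error_pushforward d (T : measurableType d)
    (P : probability T R) (f : T -> X * bool) :
  measurable_fun setT f ->
  measurable_fun setT (fun h => error (pushforward P f) (ev h)).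
Proof.
move=> mf.
pose g : {mfun T >-> (X * bool)%type} :=
  HB.pack f (isMeasurableFun.Build _ _ _ _ f mf).
exact: (ev_meas.2 (distribution P g)).
Qed.

(** Disagreement with [c] is the error under the law of [(x, c x)]. *)
Lemma measurable_disagreement (D : probability X R) (c : X -> bool) :
  measurable_fun setT c ->
  measurable_fun setT (fun h => disagreement D (ev h) c).
Proof.
move=> mc; apply: (@measurable_error_pushforward _ _ D (fun x => (x, c x))).
exact: measurable_fun_pair.
Qed.

Lemma measurable_label (c : 'I_k -> X -> bool) :
  (forall j, measurable_fun setT (c j)) -> measurable_fun setT (label c).
Proof.
move=> mc; apply: measurable_fun_pair => //; apply/measurable_fun_tnthP => j.
rewrite (_ : _ \o _ = c j)//.
by apply/funext => x; rewrite /= tnth_mktuple.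
Qed.

Lemma measurable_proj_label (j : 'I_k) :
  measurable_fun setT (@proj_label _ X k j).
Proof.
apply: measurable_fun_pair => //.
by apply: (measurableT_comp (measurable_tnth j)).
Qed.

Lemma emp_error_size0 m (S : m.-tuple (X * bool)) h :
  m = 0%N -> emp_error R S h = 0.
Proof.
by move=> m0; rewrite /emp_error (_ : m%:R = 0%R :> R) ?invr0 ?mulr0// m0.
Qed.

Lemma emp_regret_size0 m (S : m.-tuple (X * bool)) h :
  m = 0%N ->
  emp_error R S h - ereal_inf [set emp_error R S c | c in C] =
  0 - ereal_inf [set (0 : \bar R) | c in C].
Proof.
move=> m0; rewrite emp_error_size0//; congr (_ - ereal_inf _).
by apply: eq_imagel => c _; exact: emp_error_size0.
Qed.

Lemma emp_error_label m (m_gt0 : (0 < m)%N) (c : 'I_k -> X -> bool)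
    (xs : m.-tuple X) (j : 'I_k) h :
  emp_error R [tuple of map (proj_label j) [tuple of map (label c) xs]] h =
  disagreement (emp_measure R m_gt0 xs) h (c j).
Proof.
rewrite /disagreement emp_measure_count /emp_error /= !count_map.
congr ((_%:R / _)%:E); apply: eq_count => x /=.
by rewrite tnth_mktuple.
Qed.

Lemma emp_error_proj_label m (m_gt0 : (0 < m)%N)
    (S : m.-tuple (X * k.-tuple bool)) (j : 'I_k) h :
  emp_error R [tuple of map (proj_label j) S] h =
  error (pushforward (emp_measure R m_gt0 S) (proj_label j)) h.
Proof.
by rewrite /error /pushforward /= emp_measure_count /emp_error /= count_map.
Qed.

Lemma emp_regret_proj_label m (m_gt0 : (0 < m)%N)
    (S : m.-tuple (X * k.-tuple bool)) (j : 'I_k) h :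
  let err := error (pushforward (emp_measure R m_gt0 S) (proj_label j)) in
  let emp := emp_error R [tuple of map (proj_label j) S] in
  emp h - ereal_inf [set emp c | c in C] = err h - ereal_inf [set err c | c in C].
Proof.
rewrite /= emp_error_proj_label; congr (_ - ereal_inf _).
by apply: eq_imagel => c _; exact: emp_error_proj_label.
Qed.

Lemma subsample_accurate n m (mn_gt0 : (0 < m ^ n)%N) (alpha beta : R)
    (A : R.-pker (n.-tuple (X * k.-tuple bool)) ~> (k.-tuple H)) :
  (0 < n -> 0 < m)%N -> (n = 0 -> m = 0)%N ->
  (forall c, C c -> measurable_fun setT c) ->
  PAC_learner ev C alpha beta A ->
  empirical_learner ev C alpha beta (subsample A mn_gt0).
Proof.
move=> nm_gt0 nm0 C_meas pac c xs cC; lazy zeta.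
have mc j : measurable_fun setT (c j) by exact: C_meas.
have [n0|n0] := posnP n.
  have m0 := nm0 n0.
  subst n.
  (* A sample of size 0 is the empty tuple under any distribution. Empirical errors at [m = 0] are 0
     by the convention on division, hence below every disagreement, so the empirical failure event
     is contained in the PAC one. *)
  have := pac \d_(point : X) c cC; rewrite integral_iid0; apply: le_trans.
  rewrite subsample_size0.
  have -> : [tuple of map (label c) [tuple]] = [tuple] by exact: val_inj.
  under eq_set do under eq_fun do rewrite emp_error_size0//.
  apply: le_measure; rewrite ?inE.
  - exact: (@measurable_max_over_gt (fun=> cst 0)).
  - apply: (@measurable_max_over_gt (fun j h => disagreement _ (ev h) (c j))) => j.
    exact: measurable_disagreement.
  - move=> hs /= /max_over_gtP[j aj]; apply/max_over_gtP; exists j.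
    by rewrite (lt_le_trans aj).
have m_gt0 := nm_gt0 n0.
under eq_set do under eq_fun do rewrite emp_error_label.
rewrite (subsample_map_iid _ m_gt0); last 2 first.
- exact: measurable_label.
- apply: (@measurable_max_over_gt (fun j h => disagreement _ (ev h) (c j))) => j.
    exact: measurable_disagreement.
exact: pac.
Qed.

Lemma subsample_agnostic_accurate n m (mn_gt0 : (0 < m ^ n)%N) (alpha beta : R)
    (A : R.-pker (n.-tuple (X * k.-tuple bool)) ~> (k.-tuple H)) :
  (0 < n -> 0 < m)%N -> (n = 0 -> m = 0)%N ->
  agnostic_PAC_learner ev C alpha beta A ->
  agnostic_empirical_learner ev C alpha beta (subsample A mn_gt0).
Proof.
move=> nm_gt0 nm0 pac S; lazy zeta.
have merr (P : probability (X * k.-tuple bool)%type R) (a : \bar R) j :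
    measurable_fun setT (fun h =>
      error (pushforward P (proj_label j)) (ev h) - a).
  apply: emeasurable_funB => //.
  by apply: measurable_error_pushforward; exact: measurable_proj_label.
have [n0|n0] := posnP n.
  have m0 := nm0 n0.
  subst n.
  (* Labeling the point mass by a concept of [C], if there is one, makes the infimum of the errors
     at most 0. Every population regret is then at least 0, while the regret on an empty database is
     at most 0. *)
  have [c0 Cc0] : exists c0 : X -> bool, C !=set0 -> C c0.
    by have [[c0 Cc0]|nC] := pselect (C !=set0); [exists c0|exists (fun=> true)].
  pose z : X * k.-tuple bool := (point, [tuple c0 point | j < k]).
  have := pac \d_z; lazy zeta; rewrite integral_iid0; apply: le_trans.
  rewrite subsample_size0.
  under eq_set do under eq_fun do rewrite emp_regret_size0//.
  apply: le_measure; rewrite ?inE.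
  - exact: (@measurable_max_over_gt (fun=> cst _)).
  - apply: (@measurable_max_over_gt
      (fun j h => error (pushforward \d_z (proj_label j)) (ev h) - _)) => j.
    exact: merr.
  - move=> hs /= /max_over_gtP[j aj]; apply/max_over_gtP; exists j.
    apply: (lt_le_trans aj).
    (* For empty [C] the infimum is [+oo] and the empirical regret is [-oo], below anything. *)
    have [C0|/nonemptyPn C0] := pselect (C !=set0); last first.
      by rewrite C0 !image_set0 ereal_inf0 /= leNye.
    apply: (@le_trans _ _ 0).
      by rewrite sub0e oppe_le0; apply: le_ereal_inf_tmp => _ [c _ <-].
    apply: adde_ge0; first by rewrite /error /pushforward measure_ge0.
    rewrite oppe_ge0; apply: ereal_inf_lbound; exists c0; first exact: Cc0.
    rewrite /error /pushforward /= diracE memNset//=.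
    by rewrite tnth_mktuple eqxx.
have m_gt0 := nm_gt0 n0.
under eq_set do under eq_fun do rewrite emp_regret_proj_label.
rewrite (subsample_iid _ m_gt0); last first.
  apply: (@measurable_max_over_gt (fun j h =>
    error (pushforward (emp_measure R m_gt0 S) (proj_label j)) (ev h) - _)) => j.
  exact: merr.
exact: pac.
Qed.

End accuracy.

Theorem theorem2p24 (R : realType) (dX dH : measure_display)
    (X : measurableType dX) (H : measurableType dH)
    (ev : H -> X -> bool) (C : set (X -> bool)) (k n : nat)
    (eps delta alpha beta : R)
    (ev_meas : measurable_hypotheses R ev)
    (C_meas : forall c, C c -> measurable_fun [set: X] c)
    (eps_ge0 : 0 <= eps) (eps_le1 : eps <= 1)
    (A : R.-pker (n.-tuple (X * k.-tuple bool)) ~> (k.-tuple H))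
    (A_private : diff_private eps delta A) :
  (PAC_learner ev C alpha beta A ->
   exists A' : R.-pker ((9 * n)%N.-tuple (X * k.-tuple bool)) ~> (k.-tuple H),
     [/\ diff_private eps delta A',
         empirical_learner ev C alpha beta A'
       & proper_learner ev C A -> proper_learner ev C A'])
  /\
  (agnostic_PAC_learner ev C alpha beta A ->
   exists A' : R.-pker ((9 * n)%N.-tuple (X * k.-tuple bool)) ~> (k.-tuple H),
     [/\ diff_private eps delta A',
         agnostic_empirical_learner ev C alpha beta A'
       & proper_learner ev C A -> proper_learner ev C A']).
Proof.
(* At [n = 0] this holds because [0 ^ 0 = 1]: the empty index tuple is the only draw. *)
have mn_gt0 : (0 < (9 * n) ^ n)%N by case: (n) => // n'; rewrite expn_gt0.
have m_gt0 : (0 < n -> 0 < 9 * n)%N by rewrite muln_gt0.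
have m0 : (n = 0 -> 9 * n = 0)%N by move=> ->.
have eps01 : 0 <= eps <= 1 by rewrite eps_ge0.
have A'_private := subsample_diff_private mn_gt0 eps01 A_private.
have A'_proper : proper_learner ev C A ->
    proper_learner ev C (subsample A mn_gt0).
  by move=> proper S; exact: subsample_ae.
split=> accurate; exists (subsample A mn_gt0); split => //.
- exact: subsample_accurate.
- exact: subsample_agnostic_accurate.
Qed.
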